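(* Let $F$ be a tame Fréchet space, $N$ a tame Fréchet manifold modelled on $F$, and $M\subset N$ a tame Fréchet submanifold of co-Banach type. Then $M$, endowed with the topology induced from $N$, is a tame Fréchet manifold.
   Context: A Fréchet space is a complete, Hausdorff, metrizable locally convex topological vector space. A grading on it is a sequence of seminorms $\|\cdot\|_0\le\|\cdot\|_1\le\|\cdot\|_2\le\dots$ defining the topology; a graded Fréchet space is one with a chosen grading. A Banach space is graded by taking all $\|\cdot\|_n$ equal to its norm; a closed subspace carries the restricted seminorms. A linear map $L:F\to G$ of graded Fréchet spaces is tame if there are $r,b\in\mathbb N_0$ and constants $C(n)>0$ with $\|L f\|_n\le C(n)\|f\|_{n+r}$ for all $n\ge b$ and all $f$. $F$ is a tame direct summand of $G$ if there are tame linear maps $F\to G\to F$ whose composition is the identity of $F$. For a Banach space $E$, $\Sigma(E)$ is the space of sequences $(f_k)_{k\ge0}$ in $E$ with $\sum_k e^{nk}\|f_k\|<\infty$ for all $n$, graded by $\|f\|_n=\sum_k e^{nk}\|f_k\|$. A tame Fréchet space is a graded Fréchet space that is a tame direct summand of $\Sigma(E)$ for some Banach space $E$. A (nonlinear) map $\Phi:U\subset F\to G$ is tame if there are $r,b\in\mathbb N_0$ and $C(n)>0$ with $\|\Phi(f)\|_n\le C(n)(1+\|f\|_{n+r})$ for all $n>b$ and $f\in U$. A smooth tame map is a smooth map (all directional derivatives $D^k\Phi(f)\{h_1,\dots,h_k\}$ exist and are jointly continuous) that is tame. A tame Fréchet manifold is a manifold with charts in a tame Fréchet space whose chart transition functions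 are smooth tame maps; its atlas is taken to be maximal with this property, and its members are called tame Fréchet charts. Tame Fréchet submanifold of co-Banach type: a subset $M$ of a tame Fréchet manifold $N$ modelled on $F$ such that there is a complemented subspace $B\subset F$ that is a Banach space, with a closed complement $F_0$ (so $F=B\times F_0$), such that for every $m\in M$ there are open sets $U(m)\subset N$ containing $m$ and $V(m)\subset F$ and a tame Fréchet chart $\varphi_m:U(m)\to V(m)$ with $\varphi_m(M\cap U(m))=F_0\cap V(m)$. *)

(* Defs.v *)
From HB Require Import structures.
From mathcomp Require Import all_boot all_order all_algebra.
From mathcomp Require Import all_classical all_reals all_analysis.

Set Implicit Arguments.
Unset Strict Implicit.
Unset Printing Implicit Defensive.

Import Order.TTheory GRing.Theory Num.Theory.
Import numFieldNormedType.Exports.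

Local Open Scope classical_set_scope.
Local Open Scope ring_scope.

(* Completeness is that of the topological vector space: in [tvsType] the
   uniformity is only required to induce the topology, not to be translation
   invariant, so the library's [cauchy] and [Complete] are not used for it. *)
Definition tvs_cauchy (R : realType) (F : tvsType R) (FF : set_system F) : Prop :=
  (fun z : F * F => z.1 - z.2) @ filter_prod FF FF --> (0 : F).

Definition tvs_complete (R : realType) (F : tvsType R) : Prop :=
  forall FF : set_system F, ProperFilter FF -> tvs_cauchy FF ->
    exists x : F, FF --> x.

Definition metrizable (R : realType) (T : topologicalType) : Prop :=
  exists d : T -> T -> R,
    [/\ forall x y, d x y = 0 <-> x = y,
        forall x y, d x y = d y x,
        forall x y z, d x z <= d x y + d y z
      & forall (x : T) (A : set T), nbhs x A <->
          exists2 e : R, 0 < e & [set y | d x y < e] `<=` A].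

(* [tvsType] already includes local convexity. *)
Definition frechet_space (R : realType) (F : tvsType R) : Prop :=
  [/\ tvs_complete F, hausdorff_space F & metrizable R F].

Definition seminorm (R : realType) (V : lmodType R) (p : V -> R) : Prop :=
  (forall x y, p (x + y) <= p x + p y) /\
  (forall (a : R) x, p (a *: x) = `|a| * p x).

(* The seminorms being increasing, the balls of single seminorms form a
   neighbourhood base of the topology that they generate. *)
Definition grading (R : realType) (F : tvsType R) (p : nat -> F -> R) : Prop :=
  [/\ forall n, seminorm (p n),
      forall n f, p n f <= p n.+1 f
    & forall (x : F) (A : set F), nbhs x A <->
        exists n, exists2 e : R, 0 < e & [set y | p n (y - x) < e] `<=` A].

Definition tame_linear (R : realType) (V W : lmodType R)
    (p : nat -> V -> R) (q : nat -> W -> R) (L : {linear V -> W}) : Prop :=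
  exists (r b : nat) (C : nat -> R), (forall n, 0 < C n) /\
    forall n f, (b <= n)%N -> q n (L f) <= C n * p (n + r)%N f.

Definition tame_direct_summand (R : realType) (V W : lmodType R)
    (p : nat -> V -> R) (q : nat -> W -> R) : Prop :=
  exists (L : {linear V -> W}) (K : {linear W -> V}),
    [/\ tame_linear p q L, tame_linear q p K & forall f, K (L f) = f].

Section SigmaSpace.
Variables (R : realType) (E : completeNormedModType R).

Definition Sigma_term (n : nat) (f : nat -> E) : R^nat :=
  fun k => expR (n * k)%:R * `|f k|.

Definition Sigma_pred : {pred nat -> E} :=
  [pred f | `[< forall n, cvgn (series (Sigma_term n f)) >]].

Lemma Sigma_submod_closed : submod_closed Sigma_pred.
Proof.
split=> [|a f g].
  apply/asboolP => n.
  have -> : Sigma_term n 0 = 0.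
    by apply/funext => k; rewrite /Sigma_term normr0 mulr0.
  by rewrite /series /=; under eq_fun do rewrite big1//; exact: is_cvg_cst.
move=> /asboolP Hf /asboolP Hg; apply/asboolP => n.
apply: (@series_le_cvg _ _ (`|a| *: Sigma_term n f + Sigma_term n g)).
- by move=> k; apply: mulr_ge0; rewrite ?expR_ge0.
- by move=> k; apply: addr_ge0; repeat apply: mulr_ge0; rewrite ?expR_ge0.
- move=> k; have -> : (`|a| *: Sigma_term n f + Sigma_term n g) k =
      expR (n * k)%:R * (`|a| * `|f k| + `|g k|).
    by rewrite mulrDr mulrCA.
  by rewrite ler_wpM2l ?expR_ge0// -normrZ; exact: ler_normD.
- by apply: is_cvg_seriesD => //; exact: is_cvg_seriesZ.
Qed.

HB.instance Definition _ :=
  GRing.isSubmodClosed.Build R (nat -> E) Sigma_pred Sigma_submod_closed.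

Record Sigma : Type := MkSigma { Sigma_seq :> nat -> E; _ : Sigma_seq \in Sigma_pred }.

HB.instance Definition _ := [isSub for Sigma_seq].
HB.instance Definition _ := [Choice of Sigma by <:].
HB.instance Definition _ := [SubChoice_isSubLmodule of Sigma by <:].

Definition Sigma_grading (n : nat) (f : Sigma) : R :=
  limn (series (Sigma_term n f)).

End SigmaSpace.

Definition tame_frechet_space (R : realType) (F : tvsType R)
    (p : nat -> F -> R) : Prop :=
  [/\ frechet_space F, grading p
    & exists E : completeNormedModType R,
        tame_direct_summand p (@Sigma_grading R E)].

(* Maps defined on an open set [U] are represented by total functions whose
   values outside [U] are irrelevant.
   [D [:: h1; ...; hk] f] is the k-th derivative at [f] in the directions
   h1, ..., hk. *)
Definition smooth_on (R : realType) (F G : tvsType R) (U : set F)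
    (Phi : F -> G) : Prop :=
  exists D : seq F -> F -> G,
    [/\ forall f, U f -> D [::] f = Phi f,
        forall (hs : seq F) (h f : F), U f ->
          (fun t : R => t^-1 *: (D hs (f + t *: h) - D hs f)) @ 0^'
            --> D (rcons hs h) f
      & forall (k : nat) (f : F) (hs : {ptws 'I_k -> F}), U f ->
          {for (f, hs), continuous
            (fun z : F * {ptws 'I_k -> F} => D (codom z.2) z.1)}].

Definition tame_on (R : realType) (F G : tvsType R) (p : nat -> F -> R)
    (q : nat -> G -> R) (U : set F) (Phi : F -> G) : Prop :=
  exists (r b : nat) (C : nat -> R), (forall n, 0 < C n) /\
    forall n f, (b < n)%N -> U f -> q n (Phi f) <= C n * (1 + p (n + r)%N f).

Definition smooth_tame_on (R : realType) (F G : tvsType R) (p : nat -> F -> R)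
    (q : nat -> G -> R) (U : set F) (Phi : F -> G) : Prop :=
  smooth_on U Phi /\ tame_on p q U Phi.

(* A homeomorphism from an open set of [X] onto an open set of [F]; the values
   of the two functions outside these sets are irrelevant. *)
Record chart (X F : topologicalType) : Type := Chart {
  chart_dom : set X;
  chart_cod : set F;
  chart_fun :> X -> F;
  chart_inv : F -> X;
  chart_dom_open : open chart_dom;
  chart_cod_open : open chart_cod;
  chart_funS : {homo chart_fun : x / chart_dom x >-> chart_cod x};
  chart_invS : {homo chart_inv : v / chart_cod v >-> chart_dom v};
  chart_funK : forall x, chart_dom x -> chart_inv (chart_fun x) = x;
  chart_invK : forall v, chart_cod v -> chart_fun (chart_inv v) = v;
  chart_fun_continuous : {within chart_dom, continuous chart_fun};
  chart_inv_continuous : {within chart_cod, continuous chart_inv}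
}.

Section Manifold.
Variables (R : realType) (F : tvsType R) (p : nat -> F -> R).

Definition tame_atlas (X : topologicalType) (A : set (chart X F)) : Prop :=
  (forall x : X, exists2 c, A c & chart_dom c x) /\
  (forall c d, A c -> A d ->
     smooth_tame_on p p (c @` (chart_dom c `&` chart_dom d))
       (d \o chart_inv c)).

Definition maximal_tame_atlas (X : topologicalType) (A : set (chart X F)) : Prop :=
  tame_atlas A /\ forall A', tame_atlas A' -> A `<=` A' -> A' = A.

(* [X] with the atlas [A] is a tame Frechet manifold modelled on [(F, p)]. *)
Definition tame_frechet_manifold (X : topologicalType) (A : set (chart X F)) : Prop :=
  [/\ tame_frechet_space p, hausdorff_space X & maximal_tame_atlas A].

(* The topology induced on [B] is that of a Banach space. *)
Definition banach_subspace (B : set F) : Prop :=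
  exists (E : completeNormedModType R) (i : {linear E -> F}),
    [/\ range i = B, injective i
      & forall (x : E) (A : set E), nbhs x A <->
          exists2 V : set F, nbhs (i x) V & i @^-1` V `<=` A].

Definition closed_complement (B F0 : set F) : Prop :=
  [/\ submod_closed (mem F0), closed F0, B `&` F0 = [set 0]
    & forall f, exists b f0, [/\ B b, F0 f0 & f = b + f0]].

Definition cobanach_submanifold (N : topologicalType) (A : set (chart N F))
    (M : set N) : Prop :=
  exists B F0 : set F,
    [/\ banach_subspace B, closed_complement B F0
      & forall m, M m -> exists c : chart N F,
          [/\ A c, chart_dom c m
            & c @` (M `&` chart_dom c) = F0 `&` chart_cod c]].

End Manifold.

(* Main.v *)
(** The model space of [M] is the closed complement [F0] with the restricted
seminorms. The only analytic point is that the projection of [F] onto [F0]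
along the Banach space [B] is tame: its [B]-component has closed graph, so by
the closed graph theorem it is bounded by a constant times a single seminorm
[p r], and the inclusion of [B] is bounded in each [p n]; hence all the
estimates hold with the same loss [r]. This projection exhibits [F0] as a tame
direct summand and turns derivatives of a transition map of [N] into
derivatives of its restriction to [F0]. Tame estimates on a fixed domain are
not local, so the charts compatible with a given atlas need not form an atlas;
the maximal atlas is obtained from Zorn's lemma instead. *)

From HB Require Import structures.
From mathcomp Require Import all_boot all_order all_algebra.
From mathcomp Require Import all_classical all_reals all_analysis.
From mathcomp Require Import lra.
Require Import Defs.

Set Implicit Arguments.
Unset Strict Implicit.
Unset Printing Implicit Defensive.

Import Order.TTheory GRing.Theory Num.Theory.
Import numFieldNormedType.Exports.

Local Open Scope classical_set_scope.
Local Open Scope ring_scope.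

(** * Initial topologies *)

Section Initial.
Variables (S : choiceType) (T : topologicalType) (f : S -> T).

Lemma cvg_initial (W : Type) (FF : set_system W) (g : W -> initial_topology f)
    (x : initial_topology f) :
  Filter FF -> (fun w => f (g w)) @ FF --> f x -> g @ FF --> x.
Proof.
move=> FFF FFx A [_ [[B Bop <-] Bx BA]].
have := FFx B (open_nbhs_nbhs (conj Bop Bx)).
by apply: (@filterS _ FF) => w; exact: BA.
Qed.

Lemma initial_hausdorff :
  injective f -> hausdorff_space T -> hausdorff_space (initial_topology f).
Proof.
move=> f_inj Th x y xy; apply: f_inj; apply: Th => A B Ax By.
have [//|//|z [Az Bz]] := xy (f @^-1` A) (f @^-1` B); last by exists (f z).
- exact: initial_continuous.
- exact: initial_continuous.
Qed.

End Initial.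

(** * Linear subspaces as locally convex spaces *)

Section LinearSubspace.
Variables (R : realType) (F : tvsType R) (S : set F).
Hypothesis HS : submod_closed (mem S).

(* Structures can be attached to this predicate, which carries the proof that it
   is closed under the linear operations. *)
Definition subspace_pred of submod_closed (mem S) : {pred F} := mem S.

HB.instance Definition _ :=
  GRing.isSubmodClosed.Build R F (subspace_pred HS) HS.

Record linear_subspace : Type := LinearSubspace {
  subspace_val :> F; _ : subspace_val \in subspace_pred HS }.

HB.instance Definition _ := [isSub for subspace_val].
HB.instance Definition _ := [Choice of linear_subspace by <:].
HB.instance Definition _ := [SubChoice_isSubLmodule of linear_subspace by <:].
HB.instance Definition _ :=
  Uniform.copy linear_subspace (initial_topology subspace_val).

Lemma subspace_valP (x : linear_subspace) : S x.
Proof. by have := valP x; rewrite inE. Qed.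

Lemma subspace_val_continuous : continuous subspace_val.
Proof. exact: (@initial_continuous _ F subspace_val). Qed.

Lemma cvg_subspace (T : Type) (FF : set_system T) (f : T -> linear_subspace)
    (x : linear_subspace) :
  Filter FF -> (fun t => f t : F) @ FF --> (x : F) -> f @ FF --> x.
Proof. exact: (@cvg_initial _ F subspace_val). Qed.

Lemma subspace_add_continuous :
  continuous (fun x : linear_subspace * linear_subspace => x.1 + x.2).
Proof.
move=> [x y]; apply: cvg_subspace.
change ((fun z : linear_subspace * linear_subspace =>
  (z.1 : F) + (z.2 : F)) @ (x, y) --> (x : F) + (y : F)).
apply: (@continuous2_cvg _ _ _ _ _ _ _ _ (fun u v : F => u + v)).
- exact: (@add_continuous F (x : F, y : F)).
- apply: (@cvg_comp _ _ _ fst subspace_val _ _ _ cvg_fst).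
  exact: subspace_val_continuous.
- apply: (@cvg_comp _ _ _ snd subspace_val _ _ _ cvg_snd).
  exact: subspace_val_continuous.
Qed.

Lemma subspace_scale_continuous :
  continuous (fun z : R^o * linear_subspace => z.1 *: z.2).
Proof.
move=> [k x]; apply: cvg_subspace.
change ((fun z : R^o * linear_subspace => z.1 *: (z.2 : F)) @ (k, x) -->
  k *: (x : F)).
apply: (@continuous2_cvg _ _ _ _ _ _ _ _ (fun (u : R^o) (v : F) => u *: v)).
- exact: (@scale_continuous R F (k, x : F)).
- exact: cvg_fst.
- apply: (@cvg_comp _ _ _ snd subspace_val _ _ _ cvg_snd).
  exact: subspace_val_continuous.
Qed.

Lemma subspace_nbhsP (x : linear_subspace) (A : set linear_subspace) :
  nbhs x A <-> exists2 V : set F, nbhs (x : F) V & subspace_val @^-1` V `<=` A.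
Proof.
split=> [[_ [[V Vop <-] Vx VA]]|[V Vx VA]].
  by exists V => //; exact: open_nbhs_nbhs.
by apply: (filterS VA); exact: subspace_val_continuous.
Qed.

HB.instance Definition _ := PreTopologicalNmodule_isTopologicalNmodule.Build
  linear_subspace subspace_add_continuous.
HB.instance Definition _ := TopologicalNmodule_isTopologicalLmodule.Build
  R linear_subspace subspace_scale_continuous.

Lemma subspace_locally_convex :
  exists2 B : set_system linear_subspace,
    (forall b, b \in B -> convex_set b) & basis B.
Proof.
have [B Bc [Bo Bb]] := @locally_convex R F.
exists [set subspace_val @^-1` b | b in B].
  move=> _ /[!inE] -[b Bb' <-] x y l /[!inE] xb yb /=.
  have := Bc b (mem_set Bb') (subspace_val x) (subspace_val y) l (mem_set xb)
    (mem_set yb).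
  by rewrite inE.
split; first by move=> _ [b Bb' <-]; exists b => //; exact: Bo.
move=> x A [_ [[C Cop <-] Cx CA]].
have [b [Bb' bx bC]] := Bb (subspace_val x) C (open_nbhs_nbhs (conj Cop Cx)).
exists (subspace_val @^-1` b); first by split => //; exists b.
by apply: subset_trans CA => y /bC.
Qed.

HB.instance Definition _ :=
  Uniform_isTvs.Build R linear_subspace subspace_locally_convex.

End LinearSubspace.

(** * Seminorms, gradings and Baire's theorem *)

Lemma half_exp_small (R : realType) (e : R) :
  0 < e -> exists K, (2^-1 : R) ^+ K < e.
Proof.
move=> e0; have := @cvg_expr R 2^-1.
rewrite ger0_norm ?invr_ge0// invf_lt1// ltr1n => /(_ isT).
move=> /cvgrPdist_lt /(_ _ e0)[K _ /(_ K (leqnn _))].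
by rewrite sub0r normrN ger0_norm ?exprn_ge0 ?invr_ge0// => ?; exists K.
Qed.

Section Seminorm.
Variables (R : realType) (V : lmodType R) (p : V -> R).
Hypothesis Hp : seminorm p.

Lemma seminorm0 : p 0 = 0.
Proof. by rewrite -(scale0r 0) Hp.2 normr0 mul0r. Qed.

Lemma seminormN x : p (- x) = p x.
Proof. by rewrite -scaleN1r Hp.2 normrN1 mul1r. Qed.

Lemma seminormBC x y : p (x - y) = p (y - x).
Proof. by rewrite -seminormN opprB. Qed.

Lemma seminorm_ge0 x : 0 <= p x.
Proof. by have := Hp.1 x (- x); rewrite subrr seminorm0 seminormN; lra. Qed.

Lemma seminormB_le y x z : p (x - z) <= p (x - y) + p (y - z).
Proof. by rewrite -{1}(subrK y x) -addrA; exact: Hp.1. Qed.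

End Seminorm.

Section Grading.
Variables (R : realType) (F : tvsType R) (p : nat -> F -> R).
Hypothesis Hp : grading p.

Lemma grading_seminorm n : seminorm (p n).
Proof. by have [+ _ _] := Hp. Qed.

Lemma grading_le m n x : (m <= n)%N -> p m x <= p n x.
Proof.
move=> /subnK <-; elim: (n - m)%N => // k IH.
by apply: le_trans IH _; have [_ + _] := Hp; exact.
Qed.

Lemma grading_cvgP (T : Type) (FF : set_system T) (f : T -> F) (x : F) :
  Filter FF ->
  f @ FF --> x <->
  forall n e, 0 < e -> \forall t \near FF, p n (f t - x) < e.
Proof.
move=> FFF; have [_ _ nbhsP] := Hp; split=> [fx n e e0|H A].
  by apply: (fx [set y | p n (y - x) < e]); apply/nbhsP; exists n, e.
move=> /nbhsP[n [e e0 eA]].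
by apply: (filterS _ (H n e e0)) => t; exact: eA.
Qed.

Lemma grading_bounded_cvg (T : Type) (FF : set_system T) (f : T -> F) (x y : F)
    (n : nat) (c : R) :
  ProperFilter FF -> f @ FF --> x -> (\forall t \near FF, p n (f t - y) <= c) ->
  p n (x - y) <= c.
Proof.
move=> FFF /grading_cvgP fx fy; apply/ler_addgt0Pr => e e0.
have [t [tx ty]] := filter_ex (filterI (fx n e e0) fy).
have := seminormB_le (grading_seminorm n) (f t) x y.
by rewrite (seminormBC (grading_seminorm n) x (f t)); lra.
Qed.

Lemma grading_cauchy_cvg (u : nat -> F) : tvs_complete F ->
  (forall n e, 0 < e -> exists K, forall i j, (K <= i)%N -> (K <= j)%N ->
     p n (u i - u j) < e) ->
  exists x : F, u @ \oo --> x.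
Proof.
move=> Fc uc; apply: Fc; apply/grading_cvgP => n e e0.
have [K uK] := uc n e e0.
exists (u @` [set i | (K <= i)%N], u @` [set i | (K <= i)%N]).
  by split; exists K => // i /= Ki; exists i.
by move=> [_ _] [/= [i Ki <-] [j Kj <-]]; rewrite subr0; exact: uK.
Qed.

(** The sets [W m] need not be closed, so one of them is only found to be dense in some ball.
    Otherwise shrinking balls can be chosen whose closed versions avoid [W 0], [W 1], ... in turn,
    and their centres converge to a point in no [W m]. *)
Lemma grading_baire (W : nat -> set F) : tvs_complete F ->
  (forall x, exists m, W m x) ->
  exists m x n, exists2 e : R, 0 < e & forall y, p n (y - x) < e ->
    forall k (d : R), 0 < d -> exists2 w, W m w & p k (w - y) < d.
Proof.
move=> Fc Wcover; apply: contrapT => Hno.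
(* A state [s] is the index of the set to avoid together with a ball (centre, index of the seminorm,
   radius); [t] is the next ball. *)
have step (s : nat * (F * nat * R)) : exists t : F * nat * R, 0 < s.2.2 ->
    [/\ 0 < t.2, t.2 <= s.2.2 / 2, (s.2.1.2 < t.1.2)%N,
      (forall z, p t.1.2 (z - t.1.1) <= t.2 -> p s.2.1.2 (z - s.2.1.1) < s.2.2)
      & forall z, p t.1.2 (z - t.1.1) <= t.2 -> ~ W s.1 z].
  move: s => [m [[x n] e]] /=.
  (* For a nonpositive radius nothing is claimed, so any value serves. *)
  have [e0|e0] := ltP 0 e; last by exists (0, 0%N, 0).
  have [y yx [k [d d0 Wd]]] : exists2 y, p n (y - x) < e &
      exists k, exists2 d, 0 < d & forall w, W m w -> d <= p k (w - y).
    apply: contrapT => H; apply: Hno; exists m, x, n.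
    exists e => // y yx k d d0.
    apply: contrapT => H'; apply: H; exists y => //; exists k, d => // w Ww.
    by rewrite leNgt; apply/negP => wd; apply: H'; exists w.
  (* The new seminorm dominates [p n] and [p k], and [.+1] makes the indices strictly increase.
     Halving the minimum turns the closed ball's inequality into strict ones and at least halves the
     radius. *)
  exists (y, (maxn n k).+1, Num.min d (e - p n (y - x)) / 2) => _ /=.
  have md : Num.min d (e - p n (y - x)) <= d by rewrite ge_min lexx.
  have me : Num.min d (e - p n (y - x)) <= e - p n (y - x).
    by rewrite ge_min lexx orbT.
  have m0 : 0 < Num.min d (e - p n (y - x)) by rewrite lt_min d0 subr_gt0.
  have p0 := seminorm_ge0 (grading_seminorm n) (y - x).
  split; first lra.
  - lra.
  - by rewrite ltnS leq_maxl.
  - move=> z zy; have := seminormB_le (grading_seminorm n) y z x.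
    have : p n (z - y) <= p (maxn n k).+1 (z - y).
      by apply: grading_le; rewrite leqW// leq_maxl.
    by lra.
  - move=> z zy /Wd.
    have : p k (z - y) <= p (maxn n k).+1 (z - y).
      by apply: grading_le; rewrite leqW// leq_maxr.
    by lra.
have [g gP] := choice step.
pose s := fix s j := if j is i.+1 then g (i, s i) else ((0 : F, 0%N), 1 : R).
pose x j := (s j).1.1; pose n j := (s j).1.2; pose e j := (s j).2.
have e0 j : 0 < e j.
  by elim: j => [|j IH]; [exact: ltr01 | have [] := gP (j, s j) IH].
have sP j := gP (j, s j) (e0 j).
have nj j : (j <= n j)%N.
  by elim: j => // j IH; apply: leq_ltn_trans IH _; have [] := sP j.
have ball_sub i j z : (i <= j)%N ->
    p (n j) (z - x j) <= e j -> p (n i) (z - x i) <= e i.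
  move=> /subnK <-; elim: (j - i)%N => // k IH zk; apply: IH.
  by apply: ltW; have [_ _ _ + _] := sP (k + i)%N; exact.
have xball i j : (i <= j)%N -> p (n i) (x j - x i) <= e i.
  move=> ij; apply: ball_sub ij _.
  by rewrite subrr (seminorm0 (grading_seminorm _)) ltW.
have e_le j : e j <= 2^-1 ^+ j.
  elim: j => [|j IH]; first by rewrite expr0.
  by have [_ + _ _ _] := sP j; rewrite -/(e j) exprS => /le_trans; apply; lra.
have [l xl] : exists l : F, x @ \oo --> l.
  apply: grading_cauchy_cvg => // m d d0.
  have d20 : 0 < d / 2 by rewrite divr_gt0.
  have [K Kd] := half_exp_small d20.
  (* [K] makes the radius small; [m] gives [p m <= p (n k)], because [n k >= k >= m]. *)
  exists (maxn K m) => i j; rewrite !geq_max => /andP[Ki mi] /andP[Kj mj].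
  pose k := maxn K m.
  have bound i' : (k <= i')%N -> p m (x i' - x k) < d / 2.
    move=> ki; apply: le_lt_trans Kd.
    apply: (le_trans (y := p (n k) (x i' - x k))).
      by apply: grading_le; apply: leq_trans (nj _); rewrite leq_maxr.
    apply: le_trans (xball _ _ ki) _; apply: le_trans (e_le _) _.
    by apply: ler_wiXn2l; rewrite ?leq_maxl//; lra.
  have := seminormB_le (grading_seminorm m) (x k) (x i) (x j).
  rewrite (seminormBC (grading_seminorm m) (x k) (x j)).
  have := bound i; rewrite geq_max Ki mi => /(_ isT).
  have := bound j; rewrite geq_max Kj mj => /(_ isT).
  by lra.
(* The closed ball of index [m.+1] was chosen to avoid [W m], yet it contains all later centres and
   hence their limit [l]. *)
have [m Wm] := Wcover l.
have [_ _ _ _ /(_ l)] := sP m; apply => //.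
have near_ball : \forall j \near \oo, p (n m.+1) (x j - x m.+1) <= e m.+1.
  by exists m.+1 => // j; exact: xball.
exact: grading_bounded_cvg xl near_ball.
Qed.

End Grading.

(** * The closed graph theorem *)

Section ClosedGraph.
Variables (R : realType) (F : tvsType R) (p : nat -> F -> R).
Hypothesis Hp : grading p.

(* By Baire's theorem the preimage under [L] of some ball is dense near a point,
   and the successive approximations this gives add up geometrically. *)
Lemma closed_graph_bounded (E : completeNormedModType R) (L : {linear F -> E}) :
  tvs_complete F -> closed [set z : F * E | z.2 = L z.1] ->
  exists n, exists2 C, 0 < C & forall x, `|L x| <= C * p n x.
Proof.
move=> Fc Lclosed.
have [|m [x0 [n [e e0 dense0]]]] :=
    grading_baire Hp (W := fun m => [set x | `|L x| <= m%:R]) Fc.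
  by move=> x; exists (Num.truncn `|L x|).+1; apply/ltW/truncnS_gt.
(* A difference of two points of the [m]-th set has image of norm at most [m + m]; dividing by [e]
   rescales to the unit ball. The summand 1 keeps [c] positive. *)
pose c : R := (m%:R + m%:R) / e + 1.
have c0 : 0 < c by rewrite ltr_wpDl// divr_ge0 ?addr_ge0// ltW.
have c20 : 0 < 2 * c by rewrite mulr_gt0.
have approx (r : R) x k (d : R) : 0 < r -> p n x < r -> 0 < d ->
    exists2 w, `|L w| <= c * r & p k (x - w) < d.
  move=> r0 xr d0.
  (* Scaling by [a] takes radius [e] to radius [r]. With [w1] near [a^-1 *: x + x0] and [w2] near
     [x0], the centre [x0] cancels in [a *: (w1 - w2)]; each error may be [d / a / 2]. *)
  pose a := r / e; have a0 : 0 < a by rewrite divr_gt0.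
  have ax : p n ((a^-1 *: x + x0) - x0) < e.
    rewrite addrK (grading_seminorm Hp n).2 gtr0_norm ?invr_gt0//.
    by rewrite ltr_pdivrMl// /a divfK// gt_eqF.
  have ax0 : p n (x0 - x0) < e.
    by rewrite subrr (seminorm0 (grading_seminorm Hp n)).
  have da0 : 0 < d / a / 2 by rewrite !divr_gt0.
  have [w1 /= Lw1 w1x] := dense0 _ ax k _ da0.
  have [w2 /= Lw2 w2x] := dense0 _ ax0 k _ da0.
  exists (a *: (w1 - w2)).
    rewrite linearZ linearB normrZ (gtr0_norm a0).
    have : `|L w1 - L w2| <= m%:R + m%:R.
      by apply: le_trans (ler_normB _ _) _; exact: lerD.
    move=> /(ler_wpM2l (ltW a0)) /le_trans; apply.
    rewrite /a /c mulrDl mul1r mulrAC -mulrA [leLHS]mulrC.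
    by rewrite lerDl ltW.
  have -> : x - a *: (w1 - w2) =
      a *: (((a^-1 *: x + x0) - w1) - (x0 - w2)).
    rewrite !(scalerBr, scalerDr) scalerA divff ?gt_eqF// scale1r.
    by rewrite !opprD !opprK addrACA addrK.
  rewrite (grading_seminorm Hp k).2 gtr0_norm// mulrC -ltr_pdivlMr//.
  apply: (@le_lt_trans _ _ (p k ((a^-1 *: x + x0) - w1) + p k (x0 - w2))).
    apply: le_trans ((grading_seminorm Hp k).1 _ _) _.
    by rewrite (seminormN (grading_seminorm Hp k)).
  rewrite (seminormBC (grading_seminorm Hp k) _ w1).
  rewrite (seminormBC (grading_seminorm Hp k) _ w2).
  by lra.
pose h : R := 2^-1; have h0 j : 0 < h ^+ j by rewrite exprn_gt0 ?invr_gt0.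
have hS j : h ^+ j = 2 * h ^+ j.+1 by rewrite exprS mulrA divff ?mul1r.
have unit_bound x : p n x < 1 -> `|L x| <= 2 * c.
  move=> x1.
  (* The state is a stage [j] and the remainder still to be approximated. Measuring the error at
     stage [j] in [p (n + j)] makes the remainders tend to 0 in every seminorm. *)
  have step (s : nat * F) : exists w, p n s.2 < h ^+ s.1 ->
      `|L w| <= c * h ^+ s.1 /\ p (n + s.1)%N (s.2 - w) < h ^+ s.1.+1.
    have [s1|s1] := ltP (p n s.2) (h ^+ s.1); last by exists 0.
    have [w ? ?] := approx _ _ (n + s.1)%N _ (h0 s.1) s1 (h0 s.1.+1).
    by exists w.
  have [g gP] := choice step.
  pose f := fix f j := if j is i.+1 then f i - g (i, f i) else x.
  have fn j : p n (f j) < h ^+ j.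
    elim: j => [|j IH]; first by rewrite expr0.
    have [_ /=] := gP (j, f j) IH; apply: le_lt_trans.
    by apply: (grading_le Hp); exact: leq_addr.
  (* The right-hand side is the geometric sum of [c * h ^+ k] over [i <= k < j], bounding the images
     of the successive approximants. *)
  have Lf i j : (i <= j)%N -> `|L (f i - f j)| <= 2 * c * (h ^+ i - h ^+ j).
    move=> /subnK <-; elim: (j - i)%N => [|k IH].
      by rewrite add0n !subrr linear0 normr0 mulr0.
    have [Lg _] := gP (k + i, f (k + i))%N (fn _).
    have -> : f i - f (k.+1 + i)%N = f i - f (k + i)%N + g (k + i, f (k + i))%N.
      by rewrite addSn /= opprB addrA (addrC _ (- f _)) addrCA addrA.
    rewrite linearD; apply: le_trans (ler_normD _ _) _.
    have := hS (k + i)%N; rewrite -addSn /= in Lg *; nra.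
  have fx : (fun j => x - f j) @ \oo --> x.
    apply/(grading_cvgP Hp) => k d d0; have [K Kd] := half_exp_small d0.
    exists (maxn K k).+1 => // -[//|j]; rewrite /= ltnS geq_max => /andP[Kj kj].
    rewrite addrAC subrr sub0r (seminormN (grading_seminorm Hp k)).
    have [_ /= fj] := gP (j, f j) (fn j).
    apply: le_lt_trans Kd; apply: le_trans (ler_wiXn2l _ _ (leqW Kj)); try lra.
    apply: le_trans (ltW fj); apply: (grading_le Hp).
    by apply: leq_trans kj (leq_addl _ _).
  have [y Ly] : exists y : E, (fun j => L (x - f j)) @ \oo --> y.
    apply/cvg_ex; apply: cauchy_cvg; apply: cauchy_exP => d d0.
    have [K Kd] := half_exp_small (divr_gt0 d0 c20).
    exists (L (x - f K)), K => // j /= Kj; rewrite -ball_normE /=.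
    have -> : L (x - f K) - L (x - f j) = - L (f K - f j).
      rewrite -linearB -linearN !opprB; congr (L _).
      by rewrite addrC addrA subrK.
    rewrite normrN; apply: le_lt_trans (Lf _ _ Kj) _.
    have := h0 j; have : 2 * c * h ^+ K < d by rewrite mulrC -ltr_pdivlMr.
    by rewrite mulrBr; have := mulr_gt0 c20 (h0 j); lra.
  have Ly_le : `|y| <= 2 * c.
    apply: (cvgr_to_le (cvg_norm Ly)); apply: nearW => j.
    apply: le_trans (Lf 0%N j (leq0n _)) _.
    by rewrite expr0; have := mulr_gt0 c20 (h0 j); nra.
  (* The pairs [(x - f j, L (x - f j))] lie on the graph and converge to [(x, y)]. *)
  suff <- : y = L x by [].
  apply: (closed_cvg _ Lclosed _ (x, y) (cvg_pair fx Ly)).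
  by apply: nearW => j.
exists n, (2 * c) => //.
move=> x; apply/ler_addgt0Pr => d d0.
have p0 := seminorm_ge0 (grading_seminorm Hp n) x.
(* [p n x] may vanish, so it is enlarged before dividing; the slack costs exactly [d] in
   [2 * c * a]. *)
pose a := p n x + d / (2 * c).
have a0 : 0 < a by rewrite ltr_wpDl// divr_gt0.
have /unit_bound : p n (a^-1 *: x) < 1.
  rewrite (grading_seminorm Hp n).2 gtr0_norm ?invr_gt0// ltr_pdivrMl// mulr1.
  by rewrite ltrDl divr_gt0.
rewrite linearZ normrZ gtr0_norm ?invr_gt0// ler_pdivrMl// mulrC.
move=> /le_trans; apply.
by rewrite /a mulrDr (mulrC _ (d / _)) divfK// gt_eqF.
Qed.

End ClosedGraph.

(** * Closed subspaces of graded Fréchet spaces; tame linear maps *)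

Lemma subspace_frechet (R : realType) (F : tvsType R) (S : set F)
    (HS : submod_closed (mem S)) :
  closed S -> frechet_space F -> frechet_space (linear_subspace HS).
Proof.
move=> Scl [Fc Fh [d [d0 dC d_tri nbhsP]]]; split.
- move=> FF FFF FFcauchy.
  have [|x FFx] := Fc (@subspace_val _ _ _ HS @ FF) _.
    move=> A A0.
    have /FFcauchy :
        nbhs (0 : linear_subspace HS) (@subspace_val _ _ _ HS @^-1` A).
      exact: subspace_val_continuous.
    move=> [[U V] /= [FU FV] UVA].
    exists (@subspace_val _ _ _ HS @` U, @subspace_val _ _ _ HS @` V).
      by split; [apply: (@filterS _ FF _ U) | apply: (@filterS _ FF _ V)] => // y ?;
        exists y.
    by move=> [_ _] [/= [u Uu <-] [v Vv <-]]; exact: (UVA (u, v)).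
  have Sx : x \in subspace_pred HS.
    rewrite inE; apply: (closed_cvg S Scl _ x FFx).
    by apply: nearW => y; exact: subspace_valP.
  exists (LinearSubspace Sx).
  exact: (@cvg_subspace _ _ _ HS _ FF id (LinearSubspace Sx)).
- exact: (@initial_hausdorff _ F (@subspace_val _ _ _ HS) val_inj Fh).
- exists (fun x y => d (@subspace_val _ _ _ HS x) (@subspace_val _ _ _ HS y)).
  split=> //.
  + move=> x y; split=> [/d0|->]; last exact/d0.
    exact: val_inj.
  + move=> x A; split=> [/subspace_nbhsP[V /nbhsP[e e0 eV] VA]|[e e0 eA]].
      by exists e => // y yx; apply: VA; exact: eV.
    apply/subspace_nbhsP; exists [set y | d (subspace_val x) y < e] => //.
    by apply/nbhsP; exists e.
Qed.

Lemma subspace_grading (R : realType) (F : tvsType R) (p : nat -> F -> R)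
    (S : set F) (HS : submod_closed (mem S)) :
  grading p -> grading (fun n (x : linear_subspace HS) => p n x).
Proof.
move=> [p_semi p_le nbhsP]; split=> [n|//|x A].
  by split=> *; [exact: (p_semi n).1 | exact: (p_semi n).2].
split=> [/subspace_nbhsP[V /nbhsP[n [e e0 eV]] VA]|[n [e e0 eA]]].
  by exists n, e => // y yx; apply: VA; exact: eV.
apply/subspace_nbhsP; exists [set y | p n (y - subspace_val x) < e] => //.
by apply/nbhsP; exists n, e.
Qed.

Lemma tame_linear_comp (R : realType) (U V W : lmodType R) (p : nat -> U -> R)
    (q : nat -> V -> R) (s : nat -> W -> R) (L : {linear U -> V})
    (K : {linear V -> W}) :
  tame_linear p q L -> tame_linear q s K -> tame_linear p s (K \o L).
Proof.
move=> [r [b [C [C0 LC]]]] [r' [b' [C' [C'0 KC]]]].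
exists (r' + r)%N, (maxn b b'), (fun n => C' n * C (n + r')%N).
split=> [n|n f]; first exact: mulr_gt0.
rewrite geq_max => /andP[bn b'n] /=; apply: le_trans (KC _ _ b'n) _.
rewrite -mulrA ler_wpM2l//; first exact: ltW.
by rewrite addnA; apply: LC; exact: leq_trans bn (leq_addr _ _).
Qed.

Lemma tame_linear_continuous (R : realType) (F G : tvsType R)
    (p : nat -> F -> R) (q : nat -> G -> R) (L : {linear F -> G}) :
  grading p -> grading q -> tame_linear p q L -> continuous L.
Proof.
move=> Hp Hq [r [b [C [C0 LC]]]] x.
apply/(grading_cvgP Hq) => n e e0.
have [_ _ nbhsP] := Hp; apply/nbhsP.
(* The tame estimate starts at degree [b]; below it, [q n] is dominated by [q (maxn n b)]. *)
exists (maxn n b + r)%N, (e / C (maxn n b)); first exact: divr_gt0.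
move=> y /=; rewrite ltr_pdivlMr// mulrC -linearB => yx.
apply: le_lt_trans (grading_le Hq _ (leq_maxl n b)) _.
by apply: le_lt_trans yx; apply: LC; exact: leq_maxr.
Qed.

(** * The projection along a Banach subspace *)

Section Complement.
Variables (R : realType) (F : tvsType R) (p : nat -> F -> R) (B F0 : set F).
Hypothesis Hp : grading p.

Lemma continuous_linear_bounded (E : normedModType R) (i : {linear E -> F}) :
  continuous i -> forall n, exists2 C, 0 < C & forall x, p n (i x) <= C * `|x|.
Proof.
move=> ic n; have [_ _ nbhsP] := Hp; have Hn := grading_seminorm Hp n.
have : nbhs (i 0) [set y | p n y < 1].
  by rewrite linear0; apply/nbhsP; exists n, 1 => // y /=; rewrite subr0.
move=> /(ic 0) /nbhs_ballP[d /= d0 dball].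
exists (2 / d) => [|x]; first by rewrite divr_gt0.
have [->|x0] := eqVneq x 0; first by
  rewrite linear0 (seminorm0 Hn) normr0 mulr0.
have nx : 0 < `|x| by rewrite normr_gt0.
(* This scales [x] to norm [d / 2], strictly inside the ball of radius [d]. *)
pose a := d / 2 / `|x|; have a0 : 0 < a by rewrite !divr_gt0.
have : p n (i (a *: x)) < 1.
  apply: dball; rewrite -ball_normE /= sub0r normrN normrZ gtr0_norm//.
  by rewrite /a divfK ?gt_eqF//; lra.
rewrite linearZ Hn.2 gtr0_norm// -ltr_pdivlMl// mulr1 => /ltW /le_trans; apply.
by rewrite /a !invf_div mulrC.
Qed.

Lemma complement_projection : tvs_complete F -> banach_subspace B ->
  closed_complement B F0 ->
  exists P : {linear F -> F},
    [/\ forall x, F0 (P x), forall x, F0 x -> P x = x & tame_linear p p P].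
Proof.
move=> Fc [E [i [iB i_inj nbhs_i]]] [[F00 F0lin] F0cl BF0 BF].
have i_cont : continuous i by move=> x V Vx; apply/nbhs_i; exists V.
have F0D a u v : F0 u -> F0 v -> F0 (a *: u + v).
  by move=> u0 v0; have := F0lin a u v (mem_set u0) (mem_set v0); rewrite inE.
have F0B u v : F0 u -> F0 v -> F0 (u - v).
  by move=> u0 v0; rewrite addrC -scaleN1r; exact: F0D.
have F0i e : F0 (i e) -> e = 0.
  move=> ie0; have : (B `&` F0) (i e) by split=> //; rewrite -iB; exists e.
  by rewrite BF0 /= => ie; apply: i_inj; rewrite linear0.
(* [g f] is the coordinate in [E] of the [B]-component of [f]; uniqueness of the decomposition makes
   it linear. *)
have /choice[g gP] : forall f, exists e, F0 (f - i e).
  move=> f; have [b [f0 [+ F0f0 ->]]] := BF f.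
  by rewrite -iB => -[e _ <-]; exists e; rewrite addrC addKr.
have g_uniq f e : F0 (f - i e) -> g f = e.
  move=> fe; apply/eqP; rewrite -subr_eq0; apply/eqP/F0i.
  rewrite linearB; have := F0B _ _ fe (gP f).
  by rewrite opprB addrC addrA subrK.
have g_lin : linear g.
  move=> a u v; apply: g_uniq; rewrite linearP.
  rewrite opprD addrACA -scalerBr; exact: F0D.
pose pi : {linear F -> E} := HB.pack g (GRing.isLinear.Build R F E _ g g_lin).
have [|n0 [K K0 piK]] := @closed_graph_bounded R F p Hp E pi Fc.
  (* The graph is the preimage of the closed set [F0] under a continuous map, so it is closed
     although continuity of [pi] is not yet known. *)
  have -> : [set z : F * E | z.2 = pi z.1] =
      (fun z : F * E => z.1 - i z.2) @^-1` F0.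
    apply/seteqP; split=> z /= => [->|/g_uniq //]; exact: gP.
  apply: closed_comp F0cl => z _.
  apply: (@continuous2_cvg _ _ _ _ _ _ _ _ (fun u v : F => u - v)).
  - exact: (@sub_continuous F (z.1, i z.2)).
  - exact: cvg_fst.
  - by apply: (@cvg_comp _ _ _ snd i _ _ _ cvg_snd); exact: i_cont.
pose P : {linear F -> F} := (idfun \- (i \o pi)).
have /choice[C CP] : forall n, exists C : R, 0 < C /\ 
    forall x, p n (i x) <= C * `|x|.
  by move=> n; have [C] := continuous_linear_bounded i_cont n; exists C.
exists P; split=> [x|x F0x|]; first exact: gP.
  have -> : P x = x - i (g x) by [].
  by rewrite (g_uniq x 0) linear0 subr0.
(* The [B]-component satisfies [p n (i (pi x)) <= C n * K * p n0 x], and both [p n] and [p n0] are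
   at most [p (n + n0)]. *)
exists n0, 0%N, (fun n => 1 + C n * K); split=> [n|n x _].
  by rewrite addr_gt0// mulr_gt0//; have [] := CP n.
have [Cn0 iC] := CP n.
have := (grading_seminorm Hp n).1 x (- i (pi x)).
rewrite (seminormN (grading_seminorm Hp n)) => /le_trans; apply.
rewrite mulrDl mul1r lerD// ?(grading_le Hp) ?leq_addr//.
apply: le_trans (iC _) _; rewrite -mulrA (ler_wpM2l (ltW Cn0))//.
apply: le_trans (piK x) _; rewrite (ler_wpM2l (ltW K0))//.
by rewrite (grading_le Hp)// leq_addl.
Qed.

End Complement.

(** * The range of a tame projection as a tame Fréchet space *)

Section SubspaceProjection.
Variables (R : realType) (F : tvsType R) (S : set F).
Variable HS : submod_closed (mem S).
Variables (P : {linear F -> F}) (PS : forall x, S (P x)).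

Definition subspace_proj (x : F) : linear_subspace HS :=
  @LinearSubspace _ _ _ HS (P x) (mem_set (PS x)).

Lemma subspace_proj_linear : linear subspace_proj.
Proof.
move=> a x y; apply: val_inj.
exact: (linearP P).
Qed.

HB.instance Definition _ := GRing.isLinear.Build R F (linear_subspace HS) _
  subspace_proj subspace_proj_linear.

Variable p : nat -> F -> R.
Local Notation q := (fun n (x : linear_subspace HS) => p n x).
Hypothesis HPp : tame_linear p p P.

(** The summand structure of [F] in [Sigma E] is reused: include into [F] and apply [L], then return
    by [K] and project. The composite is the identity because [P] fixes [S]. *)
Lemma subspace_tame : closed S -> (forall x, S x -> P x = x) ->
  tame_frechet_space p -> tame_frechet_space q.
Proof.
move=> Scl PK [Ff Hp [E [L [K [Lt Kt LK]]]]]; split.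
- exact: subspace_frechet.
- exact: subspace_grading.
- have vt : tame_linear q p (val : {linear linear_subspace HS -> F}).
    by exists 0%N, 0%N, (fun=> 1); split=> // n f _; rewrite mul1r addn0.
  exists E, (L \o val : {linear linear_subspace HS -> Sigma E}).
  exists (subspace_proj \o K : {linear Sigma E -> linear_subspace HS}); split.
  + exact: tame_linear_comp vt Lt.
  + exact: @tame_linear_comp _ _ _ _ _ p q K subspace_proj Kt HPp.
  + move=> f /=; rewrite LK; apply: val_inj; apply: PK; exact: subspace_valP.
Qed.

End SubspaceProjection.

(** * Existence of maximal atlases *)

Section MaximalAtlas.
Variables (R : realType) (F : tvsType R) (p : nat -> F -> R).
Variable X : topologicalType.

Lemma tame_atlas_maximal (A0 : set (chart X F)) : tame_atlas p A0 ->
  exists2 A, A0 `<=` A & maximal_tame_atlas p A.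
Proof.
move=> A0_atlas.
(* Ordering the sets [A] for which [A0]|[A] is an atlas, instead of the atlases containing [A0],
   lets the empty chain have the empty union. Two charts from a chain lie together in the larger
   member. *)
have [|A [AP Amax]] := @Zorn_bigcup _ (fun A => tame_atlas p (A0 `|` A)).
  move=> C CP Ctot; split=> [x|c d].
    by have [c A0c xc] := A0_atlas.1 x; exists c => //; left.
  have compat Y : C Y -> (A0 `|` Y) c -> (A0 `|` Y) d ->
      smooth_tame_on p p (c @` (chart_dom c `&` chart_dom d))
        (d \o chart_inv c).
    by move=> /CP[_]; exact.
  move=> [A0c|[Y CY Yc]] [A0d|[Z CZ Zd]].
  - exact: A0_atlas.2.
  - by apply: (compat Z) => //; [left|right].
  - by apply: (compat Y) => //; [right|left].
  - have [YZ|ZY] := Ctot _ _ CY CZ.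
    + by apply: (compat Z) => //; right => //; exact: YZ.
    + by apply: (compat Y) => //; right => //; exact: ZY.
exists (A0 `|` A) => [c|]; first by left.
split=> // A' A'_atlas AA'; apply/seteqP; split=> // c A'c; right.
apply: contrapT => nAc; apply: (Amax A'); last first.
  by rewrite setUC setUidl // => d A0d; apply: AA'; left.
by split=> [d Ad|/(_ c A'c)//]; apply: AA'; right.
Qed.

End MaximalAtlas.

(** * Restriction of smooth tame maps and charts to a subspace *)

Section Restriction.
Variables (R : realType) (F : tvsType R) (S : set F).
Variable HS : submod_closed (mem S).
Variables (P : {linear F -> F}) (PS : forall x, S (P x)).
Hypothesis PK : forall x, S x -> P x = x.
Hypothesis P_continuous : continuous P.
Local Notation G := (linear_subspace HS).
Local Notation incl := (@subspace_val _ _ _ HS).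
Local Notation proj := (subspace_proj HS PS).

Lemma subspace_proj_continuous : continuous proj.
Proof. by move=> x; apply: cvg_subspace; exact: P_continuous. Qed.

Lemma subspace_valK : cancel incl proj.
Proof. by move=> x; apply: val_inj; apply: PK; exact: subspace_valP. Qed.

Lemma subspace_projK x : S x -> proj x = x :> F.
Proof. exact: PK. Qed.

(** The projection is linear and continuous, so it commutes with difference quotients and their
    limits. Applying it to [D] also gives values in [G] at all arguments, including those off [U],
    where [D] is arbitrary. *)
Lemma smooth_on_subspace (U : set F) (U' : set G) (Phi : F -> F)
    (Phi' : G -> G) :
  (forall v, U' v -> U v /\ Phi' v = Phi v :> F) ->
  smooth_on U Phi -> smooth_on U' Phi'.
Proof.
move=> UU' [D [D0 Dlim Dcont]].
exists (fun hs (v : G) => proj (D (map incl hs) (incl v))); split.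
- by move=> v /UU'[Uv vPhi]; rewrite /= D0// -vPhi subspace_valK.
- move=> hs h v /UU'[Uv _]; rewrite map_rcons.
  have := Dlim (map incl hs) h v Uv.
  move=> /(continuous_cvg _ (@subspace_proj_continuous _)).
  apply: cvg_trans; apply: near_eq_cvg; near=> t.
  by rewrite /= linearZ linearB.
- move=> k v hs /UU'[Uv _].
  (* Directions carry the topology of pointwise convergence, so continuity of this map is checked
     one coordinate at a time. *)
  pose val_dirs (h : {ptws 'I_k -> G}) : {ptws 'I_k -> F} :=
    fun i => incl (h i).
  have v_cvg : (fun z : G * {ptws 'I_k -> G} => incl z.1) @ (v, hs) --> incl v.
    apply: (@cvg_comp _ _ _ fst incl _ _ _ cvg_fst).
    exact: subspace_val_continuous.
  have hs_cvg : (fun z : G * {ptws 'I_k -> G} => val_dirs z.2) @ (v, hs) -->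
      val_dirs hs.
    apply: (@cvg_comp _ _ _ snd val_dirs _ _ _ cvg_snd).
    apply/cvg_sup => i; apply: cvg_initial.
    apply: (@cvg_comp _ _ _ (fun h : {ptws 'I_k -> G} => h i) incl).
      exact: (@proj_continuous 'I_k (fun=> G) i).
    exact: subspace_val_continuous.
  have D_cvg := continuous2_cvg (nbhs_filter (v, hs))
    (h := fun (w : F) (h : {ptws 'I_k -> F}) => D (codom h) w)
    (Dcont k (incl v) (val_dirs hs) Uv) v_cvg hs_cvg.
  have -> : (fun z : G * {ptws 'I_k -> G} =>
      proj (D (map incl (codom z.2)) (incl z.1))) =
      proj \o (fun z => D (codom (val_dirs z.2)) (incl z.1)).
    by apply/funext => z /=; rewrite !codomE -map_comp.
  have := continuous_cvg (nbhs_filter (v, hs)) (@subspace_proj_continuous _)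
    D_cvg.
  exact.
Unshelve. all: by end_near. Qed.

Lemma smooth_tame_on_subspace (p : nat -> F -> R) (U : set F) (U' : set G)
    (Phi : F -> F) (Phi' : G -> G) :
  (forall v, U' v -> U v /\ Phi' v = Phi v :> F) ->
  smooth_tame_on p p U Phi ->
  smooth_tame_on (fun n (x : G) => p n x) (fun n (x : G) => p n x) U' Phi'.
Proof.
move=> UU' [Phi_smooth [r [b [C [C0 PhiC]]]]]; split.
  exact: smooth_on_subspace UU' Phi_smooth.
exists r, b, C; split=> // n v bn /UU'[Uv ->]; exact: PhiC.
Qed.

Section RestrictChart.
Variables (N : topologicalType) (M : set N) (m0 : set_type M) (c : chart N F).
Hypothesis Hc : c @` (M `&` chart_dom c) = S `&` chart_cod c.

(** The projection only serves to land in [G]: by [Hc], [c] already takes values in [S] at points of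
    [M] in its domain. *)
Definition restrict_fun (x : set_type M) : G := proj (c (set_val x)).

(** [m0] is the value wherever [chart_inv c] leaves [M], which does not happen on the codomain of
    [c] by [Hc]. *)
Definition restrict_inv (v : G) : set_type M :=
  insubd m0 (chart_inv c (incl v)).

Lemma restrict_funE (x : set_type M) :
  chart_dom c (set_val x) -> restrict_fun x = c (set_val x) :> F.
Proof.
move=> xc; apply: subspace_projK.
have : (c @` (M `&` chart_dom c)) (c (set_val x)).
  by exists (set_val x) => //; split=> //; exact: set_valP.
by rewrite Hc => -[].
Qed.

(** This uses the surjectivity half of [Hc]: a point of [S] in the codomain is [c x] with [x] in
    [M], and [chart_inv c] sends it back to [x]. *)
Lemma restrict_invE (v : G) :
  chart_cod c (incl v) -> set_val (restrict_inv v) = chart_inv c (incl v).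
Proof.
move=> vc; apply: insubdK; rewrite inE.
have : (S `&` chart_cod c) (incl v) by split=> //; exact: subspace_valP.
by rewrite -Hc => -[x [Mx xc] <-]; rewrite chart_funK.
Qed.

Lemma restrict_dom_open : open (set_val @^-1` chart_dom c : set (set_type M)).
Proof. by exists (chart_dom c) => //; exact: chart_dom_open. Qed.

Lemma restrict_cod_open : open (incl @^-1` chart_cod c).
Proof. by exists (chart_cod c) => //; exact: chart_cod_open. Qed.

Lemma restrict_funS : {homo restrict_fun : x / (set_val @^-1` chart_dom c) x >->
  (incl @^-1` chart_cod c) x}.
Proof.
move=> x xc; change (chart_cod c (incl (restrict_fun x))).
by rewrite restrict_funE//; exact: chart_funS.
Qed.

Lemma restrict_invS : {homo restrict_inv : v / (incl @^-1` chart_cod c) v >->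
  (set_val @^-1` chart_dom c) v}.
Proof.
move=> v vc; change (chart_dom c (set_val (restrict_inv v))).
by rewrite restrict_invE//; exact: chart_invS.
Qed.

Lemma restrict_funK x : (set_val @^-1` chart_dom c) x ->
  restrict_inv (restrict_fun x) = x.
Proof.
by move=> xc; rewrite /restrict_inv restrict_funE// chart_funK//; exact: valKd.
Qed.

Lemma restrict_invK v : (incl @^-1` chart_cod c) v ->
  restrict_fun (restrict_inv v) = v.
Proof.
by move=> vc; rewrite /restrict_fun restrict_invE// chart_invK// subspace_valK.
Qed.

Lemma restrict_fun_continuous :
  {within set_val @^-1` chart_dom c, continuous restrict_fun}.
Proof.
have := @chart_fun_continuous _ _ c.
rewrite (continuous_open_subspace _ (chart_dom_open c)).
rewrite (continuous_open_subspace _ restrict_dom_open).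
move=> c_cont x; rewrite inE => xc.
have val_cvg : set_val @ x --> set_val x by exact: initial_continuous.
have c_cvg := cvg_comp _ _ val_cvg (c_cont _ (mem_set xc)).
exact: cvg_comp c_cvg (@subspace_proj_continuous _).
Qed.

Lemma restrict_inv_continuous :
  {within incl @^-1` chart_cod c, continuous restrict_inv}.
Proof.
have := @chart_inv_continuous _ _ c.
rewrite (continuous_open_subspace _ (chart_cod_open c)).
rewrite (continuous_open_subspace _ restrict_cod_open).
move=> c_cont v; rewrite inE => vc.
apply: (@cvg_initial _ _ set_val _ _ _ _ (nbhs_filter v)).
rewrite restrict_invE//.
have c_cvg := cvg_comp _ _ (@subspace_val_continuous _ _ _ HS v)
  (c_cont _ (mem_set vc)).
apply: cvg_trans c_cvg; apply: near_eq_cvg.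
have : nbhs v (incl @^-1` chart_cod c).
  by apply: open_nbhs_nbhs; split=> //; exact: restrict_cod_open.
by apply: filterS => w wc; rewrite restrict_invE.
Qed.

Definition restrict_chart : chart (set_type M) G :=
  Chart restrict_dom_open restrict_cod_open restrict_funS restrict_invS
    restrict_funK restrict_invK restrict_fun_continuous restrict_inv_continuous.

End RestrictChart.

End Restriction.

(** * The manifold structure on the submanifold *)

Theorem lemma3p5 (R : realType) (F : tvsType R) (p : nat -> F -> R)
    (N : topologicalType) (A : set (chart N F)) (M : set N)
    (hF : tame_frechet_space p)
    (hN : tame_frechet_manifold p A)
    (hM : cobanach_submanifold A M) :
  exists (G : tvsType R) (q : nat -> G -> R) (A' : set (chart (set_type M) G)),
    tame_frechet_manifold q A'.
Proof.
have [[Fc _ _] Hp _] := hF; have [_ Nh [[_ A_compat] _]] := hN.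
have [B [F0 [HB HF0 M_charts]]] := hM.
have [HS F0cl _ _] := HF0.
have [P [PS PK P_tame]] := complement_projection Hp Fc HB HF0.
have Pc : continuous P := tame_linear_continuous Hp Hp P_tame.
pose G := linear_subspace HS; pose q n (x : G) := p n x.
(* The default point [m0] is quantified inside the set because [M] may be empty; around [x], the
   point [x] itself serves. *)
pose A0 : set (chart (set_type M) G) := [set c' | exists m0 c
    (Hc : c @` (M `&` chart_dom c) = F0 `&` chart_cod c),
  A c /\ c' = restrict_chart HS PS PK Pc m0 Hc].
have A0_atlas : tame_atlas q A0.
  split=> [x|_ _ [m [c [Hc [Ac ->]]]] [m' [d [Hd [Ad ->]]]]].
    have [c [Ac xc Hc]] := M_charts (set_val x) (set_valP x).
    by exists (restrict_chart HS PS PK Pc x Hc) => //; exists x, c, Hc.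
  (* On the relevant image, the transition map of the restricted charts agrees with that of [c] and
     [d] on [N], so smoothness and the tame estimate are inherited. *)
  refine (@smooth_tame_on_subspace _ _ _ HS _ PS PK Pc p _ _ _ _ _
    (A_compat c d Ac Ad)).
  move=> _ [x [xc xd] <-].
  have c_x := restrict_funE HS PS PK Hc xc.
  have d_x := restrict_funE HS PS PK Hd xd.
  split; first by exists (set_val x) => //; rewrite -c_x.
  have -> : (d \o chart_inv c) (subspace_val (restrict_fun HS PS c x)) =
      d (set_val x).
    by rewrite c_x /= chart_funK.
  rewrite -d_x; congr (subspace_val (restrict_fun _ _ _ _)).
  exact: restrict_funK.
have [A' _ A'_max] := tame_atlas_maximal A0_atlas.
exists G, q, A'; split => //.
  exact: (@subspace_tame _ _ _ HS P PS p P_tame F0cl PK hF).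
exact: (@initial_hausdorff _ N set_val val_inj Nh).
Qed.
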